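(* Let $F$ and $H$ be graphs on $f$ and $h$ vertices, respectively, such that $\chi(H) < \chi(F)$. For every $c > 0$ there exists $c_F > 0$ such that if $G$ is an $n$-vertex graph with \[ \mathcal{N}(H,G) > \mathrm{ex}(n,H,F) + c\, n^h, \] then $\mathcal{N}(F,G) \geq c_F\, n^f$.
   Context: All graphs are finite and simple, and $\chi$ denotes the chromatic number. For graphs $H$ and $G$, $\mathcal{N}(H,G)$ denotes the number of copies of $H$ in $G$, i.e. the number of (not necessarily induced) subgraphs of $G$ isomorphic to $H$. A graph is $F$-free if it contains no copy of $F$ as a (not necessarily induced) subgraph. $\mathrm{ex}(n,H,F)$ denotes the maximum of $\mathcal{N}(H,G)$ over all $n$-vertex $F$-free graphs $G$. The constant $c_F$ may depend on $F$, $H$ and $c$, but not on $n$ or $G$. *)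

(* Defs.v *)
(* MathComp; realType comes from MathComp-Analysis. *)
From HB Require Import structures.
From mathcomp Require Import all_boot all_order all_algebra.
From mathcomp Require Import reals.
Set Implicit Arguments.
Unset Strict Implicit.
Unset Printing Implicit Defensive.

Record sgraph (V : finType) := SGraph {
  edges : {set {set V}};
  _ : [forall e in edges, #|e| == 2] }.

HB.instance Definition _ (V : finType) := [isSub for @edges V].
HB.instance Definition _ (V : finType) := [Finite of sgraph V by <:].

Definition adj (V : finType) (G : sgraph V) : rel V :=
  fun x y => [set x; y] \in edges G.

Lemma adj_irrefl (V : finType) (G : sgraph V) : irreflexive (adj G).
Proof.
move=> x; apply/negP => xx; have /forall_inP/(_ _ xx) := valP G.
by rewrite setUid cards1.
Qed.

Definition colorable (V : finType) (G : sgraph V) (k : nat) : bool :=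
  [exists col : {ffun V -> 'I_k},
     [forall x, forall y, adj G x y ==> (col x != col y)]].

Lemma colorable_exists (V : finType) (G : sgraph V) :
  exists k, colorable G k.
Proof.
exists #|V|; apply/existsP; exists [ffun x => enum_rank x].
apply/forallP => x; apply/forallP => y; apply/implyP => xy.
rewrite !ffunE (inj_eq enum_rank_inj); apply/negP => /eqP exy.
by move: xy; rewrite exy adj_irrefl.
Qed.

Definition chi (V : finType) (G : sgraph V) : nat :=
  ex_minn (colorable_exists G).

(* A subgraph of G is given by its vertex set S.1 and its edge set S.2. *)
Definition subgraph (V : finType) (G : sgraph V)
    (S : {set V} * {set {set V}}) : bool :=
  (S.2 \subset edges G) && [forall e in S.2, e \subset S.1].

(* Meant for subgraphs S: the members of S.2 are then pairs, so that both sides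
   of the last condition are false when x = y. *)
Definition iso_to (U V : finType) (H : sgraph U)
    (S : {set V} * {set {set V}}) : bool :=
  [exists phi : {ffun U -> V},
     [&& injectiveb phi, phi @: [set: U] == S.1
       & [forall x, forall y, adj H x y == ([set phi x; phi y] \in S.2)]]].

Definition copies (U V : finType) (H : sgraph U) (G : sgraph V) :
    {set {set V} * {set {set V}}} :=
  [set S | subgraph G S && iso_to H S].

Definition ncopies (U V : finType) (H : sgraph U) (G : sgraph V) : nat :=
  #|copies H G|.

Definition is_free (U V : finType) (F : sgraph U) (G : sgraph V) : bool :=
  copies F G == set0.

(* Every n-vertex graph is isomorphic to one on 'I_n.  The maximum is 0 when
   there is no F-free graph on n vertices, which requires F to be edgeless. *)
Definition ex_copies (n : nat) (U W : finType) (H : sgraph U) (F : sgraph W) : nat :=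
  \max_(G : sgraph 'I_n | is_free F G) ncopies H G.

(* Main.v *)
Require Import Defs.
From mathcomp Require Import all_boot all_order all_algebra.
From mathcomp Require Import reals.
From mathcomp Require classical_sets.
From mathcomp Require Import ring lra.
Import Order.TTheory GRing.Theory Num.Theory.
Local Open Scope ring_scope.

(** The proof averages over the vertex sets of a fixed size m.  Let h and f be
    the orders of H and F, and put a_k = ex(k, H, F) / C(k, h).  The nonnegative
    numbers a_k with k >= max(h, f) have an infimum, so some m >= max(h, f)
    satisfies a_m < a_n + c / 2 for all n >= max(h, f) at once
    ([uniform_near_inf]).

    Let n >= m.  Since C(n, h) <= n^h, the assumption gives at least a_n + c
    copies of H per h-subset of V.  The same holds on average in the subgraphs
    induced on m-sets, where the ratio thus exceeds a_m by at least c / 2.  An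
    m-set without a copy of F contains at most ex(m, H, F) copies of H, so the
    excess comes from m-sets that contain a copy of F; each of them has a number
    of copies of H bounded in terms of m, so they form a positive proportion of
    all m-sets.  A copy of F lies in C(n - f, m - f) of the m-sets, so G has at
    least a constant times C(n, f) copies of F.  The counting part is
    [supersaturation_count]; it rests on the double count [sum_copies_in].

    If n < m, then G has at least one copy of F, and this is enough once the
    constant is at most (m + 1)^(-f). *)

(** * Binomial estimates *)

Lemma mul_bin_nested {n m a : nat} : (a <= m <= n)%N ->
  ('C(n, a) * 'C(n - a, m - a) = 'C(n, m) * 'C(m, a))%N.
Proof.
case/andP=> am mn; have an := leq_trans am mn.
apply/eqP; rewrite -(@eqn_pmul2r (a`! * (m - a)`! * (n - m)`!));
  last by rewrite !muln_gt0 !fact_gt0.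
apply/eqP; transitivity (n`!).
  rewrite -(bin_fact an) -(bin_fact (leq_sub2r a mn)) subnBA // subnK //.
  ring.
rewrite -(bin_fact mn) -(bin_fact am); ring.
Qed.

Lemma bin_leq_expn (n k : nat) : ('C(n, k) <= n ^ k)%N.
Proof.
apply: (@leq_trans (n ^_ k)); first by rewrite -bin_ffact leq_pmulr ?fact_gt0.
rewrite ffact_prod -[X in (_ <= _ ^ X)%N]card_ord -prod_nat_const.
by apply: leq_prod => i _; apply: leq_subr.
Qed.

(** Compare n^k k! = prod n (k - i) with n^_k k^k = prod (n - i) k, factor by
    factor. *)
Lemma expn_leq_bin (n k : nat) : (k <= n)%N -> (n ^ k <= k ^ k * 'C(n, k))%N.
Proof.
move=> kn; rewrite -(@leq_pmul2r k`!) ?fact_gt0 // -mulnA bin_ffact.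
rewrite -ffactnn !ffact_prod.
have powE b : (b ^ k = \prod_(i < k) b)%N by rewrite prod_nat_const card_ord.
rewrite !powE -!big_split; apply: leq_prod => i _ /=.
by rewrite !mulnBr [(n * k)%N]mulnC leq_sub2l // leq_mul2r kn orbT.
Qed.

(** Such a superset S is determined by S :\: A, a subset of ~: A. *)
Lemma card_supersets {T : finType} (A : {set T}) {m : nat} : (#|A| <= m)%N ->
  #|[set S : {set T} | #|S| == m & A \subset S]| = 'C(#|T| - #|A|, m - #|A|).
Proof.
move=> Am.
have -> : (#|T| - #|A|)%N = #|~: A| by rewrite (cardsCs (~: A)) setCK.
rewrite -cards_draws -[RHS](@card_in_imset _ _ (setU A)).
  apply: eq_card => S; rewrite inE; apply/andP/imsetP => [[/eqP Sm AS]|[B]].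
    exists (S :\: A); last by rewrite setDE setUIr setUCr setIT (setUidPr AS).
    by rewrite inE setDE subsetIr -setDE cardsD (setIidPr AS) Sm /=.
  rewrite inE => /andP[BA /eqP Bm] ->; split; last exact: subsetUl.
  rewrite cardsU (_ : A :&: B = set0) ?cards0 ?subn0 ?Bm ?subnKC //.
  by apply/eqP; rewrite setI_eq0 disjoints_subset -setCS setCK.
move=> B1 B2; rewrite !inE => /andP[B1A _] /andP[B2A _] E.
have recover (B : {set T}) : B \subset ~: A -> B = (A :|: B) :\: A.
  by move=> BA; rewrite setDUl setDv set0U setDE (setIidPl BA).
by rewrite (recover _ B1A) E -recover.
Qed.

(** * Copies as images of embeddings *)

Definition embedding {U V : finType} (H : sgraph U) (G : sgraph V)
    (phi : U -> V) : Prop :=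
  injective phi /\ (forall x y, adj H x y -> adj G (phi x) (phi y)).

Definition push {U V : finType} (phi : U -> V)
    (T : {set U} * {set {set U}}) : {set V} * {set {set V}} :=
  (phi @: T.1, [set phi @: e | e : {set U} in T.2]).

Definition whole {U : finType} (H : sgraph U) : {set U} * {set {set U}} :=
  (setT, edges H).

Lemma edgeP {V : finType} {G : sgraph V} {e : {set V}} : e \in edges G ->
  exists x y, e = [set x; y] /\ adj G x y.
Proof.
move=> eG; have /forall_inP edge2 := valP G.
have /cards2P[x [y [_ exy]]] := edge2 _ eG.
by exists x, y; rewrite /adj -exy.
Qed.

Lemma imset_pair {U V : finType} (phi : U -> V) (x y : U) :
  phi @: [set x; y] = [set phi x; phi y].
Proof. by rewrite imsetU !imset_set1. Qed.

Lemma push_inj {U V : finType} {phi : U -> V} :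
  injective phi -> injective (push phi).
Proof.
move=> inj_phi [A E] [A' E'] [/imset_inj-> // EE'].
by rewrite (imset_inj (imset_inj inj_phi) EE').
Qed.

Lemma push_comp {U V W : finType} (f : V -> W) (phi : U -> V)
    (T : {set U} * {set {set U}}) : push (f \o phi) T = push f (push phi T).
Proof.
rewrite /push /= imset_comp; congr pair.
by rewrite -imset_comp; apply: eq_imset => e /=; rewrite imset_comp.
Qed.

(** The isomorphism witnessing a copy is the same datum as an embedding whose
    image is that copy; embeddings compose, which makes them easier to move
    between a graph and its induced subgraphs. *)
Lemma copiesP {U V : finType} {H : sgraph U} {G : sgraph V}
    {T : {set V} * {set {set V}}} :
  reflect (exists2 phi, embedding H G phi & T = push phi (whole H))
          (T \in copies H G).
Proof.
rewrite inE; apply: (iffP andP) => [[] | [phi [inj_phi hom_phi] ->{T}]].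
  case: T => A E /andP[/= EG /forall_inP EA].
  case/existsP=> phi /and3P[/injectiveP inj_phi /eqP/= phiA /forallP phiE].
  have adjE x y : adj H x y = ([set phi x; phi y] \in E).
    by apply/eqP; move/forallP: (phiE x).
  exists phi; first by split=> // x y; rewrite adjE; apply: (subsetP EG).
  rewrite /push /= phiA; congr pair; apply/setP=> e.
  apply/idP/imsetP => [eE | [d /edgeP[x [y [-> Hxy]]] ->]].
    have [u [v [euv _]]] := edgeP (subsetP EG _ eE).
    have := EA _ eE; rewrite -phiA euv subUset !sub1set.
    case/andP=> /imsetP[x _ ux] /imsetP[y _ vy].
    by exists [set x; y]; rewrite ?imset_pair ?ux ?vy // -/(adj H x y) adjE
      -ux -vy -euv.
  by rewrite imset_pair -adjE.
split.
  apply/andP; split; last first.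
    by apply/forall_inP => _ /imsetP[e _ ->]; apply/imsetS/subsetT.
  apply/subsetP => _ /imsetP[_ /edgeP[x [y [-> Hxy]]] ->].
  by rewrite imset_pair; apply: hom_phi.
have finE : finfun phi =1 phi by move=> x; rewrite ffunE.
apply/existsP; exists (finfun phi); apply/and3P; split.
- by apply/injectiveP => x y; rewrite !finE; apply: inj_phi.
- by rewrite (eq_imset _ finE).
apply/forallP => x; apply/forallP => y; rewrite !finE /= -imset_pair.
by rewrite (mem_imset _ _ (imset_inj inj_phi)).
Qed.

Lemma card_copy {U V : finType} {H : sgraph U} {G : sgraph V}
    {T : {set V} * {set {set V}}} : T \in copies H G -> #|T.1| = #|U|.
Proof. by case/copiesP=> phi [inj_phi _] ->; rewrite card_imset // cardsT. Qed.

(** * Copies inside a vertex set *)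

Definition copies_in {U V : finType} (H : sgraph U) (G : sgraph V)
    (S : {set V}) : {set {set V} * {set {set V}}} :=
  [set T in copies H G | T.1 \subset S].

Lemma copies_in_setT {U V : finType} (H : sgraph U) (G : sgraph V) :
  copies_in H G setT = copies H G.
Proof. by apply/setP=> T; rewrite inE subsetT andbT. Qed.

Lemma induced_subproof {V : finType} (G : sgraph V) (S : {set V}) :
  [forall e in [set e : {set 'I_#|S|} | enum_val @: e \in edges G], #|e| == 2].
Proof.
apply/forall_inP => e; rewrite inE => eG.
have /forall_inP/(_ _ eG) := valP G.
by rewrite card_imset //; apply: enum_val_inj.
Qed.

(** The vertices of S are renumbered by an initial segment of the integers
    because the extremal number ranges over graphs on such a segment. *)
Definition induced {V : finType} (G : sgraph V) (S : {set V}) :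
  sgraph 'I_#|S| := SGraph (induced_subproof G S).

Lemma adj_induced {V : finType} (G : sgraph V) (S : {set V}) (i j : 'I_#|S|) :
  adj (induced G S) i j = adj G (enum_val i) (enum_val j).
Proof. by rewrite /adj inE imset_pair. Qed.

Lemma card_copies_in {U V : finType} (H : sgraph U) (G : sgraph V)
    (S : {set V}) : #|copies_in H G S| = ncopies H (induced G S).
Proof.
have inj_val : injective (@enum_val V (mem S)) := @enum_val_inj _ _.
rewrite /ncopies -[RHS](card_imset _ (push_inj inj_val)); apply: eq_card => T; rewrite inE.
apply/andP/imsetP => [[/copiesP[phi [inj_phi hom_phi] ->] phiS] | [T']].
  have inS u : phi u \in S.
    by apply: (subsetP phiS); rewrite imset_f ?inE.
  pose psi u : 'I_#|S| := enum_rank_in (inS u) (phi u).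
  have psiK u : enum_val (psi u) = phi u by rewrite enum_rankK_in.
  exists (push psi (whole H)).
    apply/copiesP; exists psi => //; split=> [u v uv | u v].
      by apply: inj_phi; rewrite -!psiK uv.
    by rewrite adj_induced !psiK; apply: hom_phi.
  rewrite -push_comp /push; congr pair.
    by apply: eq_imset => u; exact/esym/psiK.
  apply: eq_imset => e; apply: eq_imset => u; exact/esym/psiK.
case/copiesP=> psi [inj_psi hom_psi] -> ->; split.
  apply/copiesP; exists (enum_val \o psi); last exact/esym/push_comp.
  split=> [|u v /hom_psi]; first exact: inj_comp.
  by rewrite adj_induced.
by apply/subsetP => _ /imsetP[i _ ->]; apply: enum_valP.
Qed.

Lemma copies_in_gt_ex {VF VH V : finType} {F : sgraph VF} {H : sgraph VH}
    {G : sgraph V} {S : {set V}} :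
  (ex_copies #|S| H F < #|copies_in H G S|)%N -> (0 < #|copies_in F G S|)%N.
Proof.
rewrite !card_copies_in; apply: contraLR; rewrite lt0n negbK cards_eq0 -leqNgt.
move=> freeS; exact: (leq_bigmax_cond (induced G S) freeS).
Qed.

(** A crude bound for the number of copies of any graph in a graph on m
    vertices: any bound in terms of m alone will do. *)
Definition copy_bound (m : nat) : nat := #|{: {set 'I_m} * {set {set 'I_m}}}|.

Lemma copy_bound_gt0 (m : nat) : (0 < copy_bound m)%N.
Proof. by apply/card_gt0P; exists (set0, set0). Qed.

(** Double counting of the pairs (copy, m-set around it): a copy occupies #|U|
    vertices, so the m-sets around it number a fixed binomial coefficient. *)
Lemma sum_copies_in {U V : finType} (H : sgraph U) (G : sgraph V) {m : nat} :
  (#|U| <= m)%N ->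
  (\sum_(S : {set V} | #|S| == m) #|copies_in H G S| =
   ncopies H G * 'C(#|V| - #|U|, m - #|U|))%N.
Proof.
move=> Um.
under eq_bigr => S _ do rewrite -sum1dep_card big_mkcondr /=.
rewrite exchange_big /= -sum_nat_const; apply: eq_bigr => T TG.
rewrite -big_mkcondr /= sum1dep_card -(card_copy TG).
by rewrite card_supersets // (card_copy TG).
Qed.

(** An m-set without a copy of F carries at most [ex_copies m H F] copies of H,
    and any other one at most [copy_bound m].  Sum over all m-sets. *)
Lemma supersaturation_count {VF VH V : finType} (F : sgraph VF) (H : sgraph VH)
    (G : sgraph V) {m : nat} : (#|VH| <= m)%N -> (#|VF| <= m)%N ->
  (ncopies H G * 'C(#|V| - #|VH|, m - #|VH|) <=
   ex_copies m H F * 'C(#|V|, m) +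
   copy_bound m * (ncopies F G * 'C(#|V| - #|VF|, m - #|VF|)))%N.
Proof.
move=> hm fm; rewrite -!sum_copies_in // -(card_draws V m) -sum1dep_card.
rewrite !big_distrr /= -big_split /=; apply: leq_sum => S /eqP Sm.
rewrite muln1; case: (leqP #|copies_in H G S| (ex_copies m H F)) => [le | gt].
  exact: leq_trans le (leq_addr _ _).
have F_in_S : (0 < #|copies_in F G S|)%N.
  by apply: copies_in_gt_ex; rewrite Sm; exact: gt.
apply: leq_trans (leq_addl _ _); apply: leq_trans (leq_pmulr _ F_in_S).
by rewrite card_copies_in /copy_bound -Sm max_card.
Qed.

(** * The supersaturation theorem *)

(** A single m serves for all n because the infimum over the indices >= k lies
    below every such term. *)
Lemma uniform_near_inf {R : realType} (a : nat -> R) (k : nat) {e : R} :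
  0 < e -> (forall n, 0 <= a n) ->
  exists2 m, (k <= m)%N & forall n, (k <= n)%N -> a m < a n + e.
Proof.
move=> e0 a0.
pose A : classical_sets.set R := fun x => exists2 n, (k <= n)%N & a n = x.
have lbA : classical_sets.has_lbound A by exists 0 => _ [n _ <-].
have infA : classical_sets.has_inf A by split=> //; exists (a k), k.
have [_ [m /= km <-] lt_m] := inf_adherent e0 infA.
exists m => // n kn; apply: (lt_le_trans lt_m).
by rewrite lerD2r; apply: (ge_inf lbA); exists n.
Qed.

Theorem theorem4 (R : realType) (VF VH : finType)
    (F : sgraph VF) (H : sgraph VH) (hchi : (chi H < chi F)%N)
    (c : R) (hc : 0 < c) :
  exists2 cF : R, 0 < cF &
    forall (n : nat) (V : finType) (G : sgraph V), #|V| = n ->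
      (ncopies H G)%:R > (ex_copies n H F)%:R + c * n%:R ^+ #|VH| ->
      (ncopies F G)%:R >= cF * n%:R ^+ #|VF|.
Proof.
set h := #|VH|; set f := #|VF|.
pose a n : R := (ex_copies n H F)%:R / ('C(n, h))%:R.
have c2_gt0 : 0 < c / 2 by lra.
have [] := uniform_near_inf a (maxn h f) c2_gt0.
  by move=> n; rewrite divr_ge0 ?ler0n.
move=> m; rewrite geq_max => /andP[hm fm] am.
pose K := (copy_bound m * 'C(m, f) * f ^ f)%N.
have K_gt0 : (0 < K)%N.
  by rewrite /K !muln_gt0 copy_bound_gt0 bin_gt0 fm expn_gt0; case: (f).
(* The first term serves for n >= m, the second one for n < m; the successor
   keeps the base positive when m = 0. *)
exists (Num.min ((c / 2) / K%:R) (m.+1%:R ^- f)).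
  by rewrite lt_min divr_gt0 ?ltr0n // invr_gt0 exprn_gt0 ?ltr0n.
move=> n V G Vn NH.
have n0 : 0 <= n%:R ^+ f :> R by rewrite exprn_ge0 ?ler0n.
have [nm | mn] := ltnP n m.
  have NF : 1 <= (ncopies F G)%:R :> R.
    rewrite ler1n /ncopies -copies_in_setT; apply: (@copies_in_gt_ex _ _ _ _ H).
    rewrite copies_in_setT cardsT Vn -(ltr_nat R).
    by apply: le_lt_trans NH; rewrite lerDl mulr_ge0 ?exprn_ge0 ?ler0n ?ltW.
  apply: le_trans NF.
  apply: (@le_trans _ _ (m.+1%:R ^- f * n%:R ^+ f)).
    by rewrite ler_wpM2r // ge_min lexx orbT.
  rewrite mulrC ler_pdivrMr ?exprn_gt0 ?ltr0n // mul1r.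
  by rewrite lerXn2r ?nnegrE ?ler0n // ler_nat ltnW // ltnW.
apply: (@le_trans _ _ ((c / 2) / K%:R * n%:R ^+ f)).
  by rewrite ler_wpM2r // ge_min lexx.
rewrite mulrAC ler_pdivrMr ?ltr0n //.
have hn := leq_trans hm mn; have fn := leq_trans fm mn.
have count := supersaturation_count F H G hm fm.
rewrite Vn -(ler_nat R) natrD !natrM -/h -/f in count.
have bin_pos (p q : nat) : (q <= p)%N -> 0 < 'C(p, q)%:R :> R.
  by move=> qp; rewrite ltr0n bin_gt0.
have idH : ('C(n, h))%:R * ('C(n - h, m - h))%:R
    = ('C(n, m))%:R * ('C(m, h))%:R :> R.
  by rewrite -!natrM mul_bin_nested ?hm.
have idF : ('C(n, f))%:R * ('C(n - f, m - f))%:R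
    = ('C(n, m))%:R * ('C(m, f))%:R :> R.
  by rewrite -!natrM mul_bin_nested ?fm.
have exE k : (h <= k)%N -> (ex_copies k H F)%:R = a k * ('C(k, h))%:R.
  by move=> hk; rewrite /a divfK // gt_eqF ?bin_pos.
have dense : (a n + c) * ('C(n, h))%:R <= (ncopies H G)%:R.
  apply: le_trans (ltW NH); rewrite mulrDl -exE // lerD2l ler_pM2l //.
  by rewrite -natrX ler_nat bin_leq_expn.
have excess : c / 2 * ('C(n, m)%:R * ('C(m, h))%:R)
    <= (copy_bound m)%:R * ((ncopies F G)%:R * ('C(n - f, m - f))%:R).
  have lo := ler_wpM2r (ler0n R 'C(n - h, m - h)) dense.
  rewrite -mulrA idH in lo; rewrite (exE _ hm) in count.
  set P := 'C(n, m)%:R * _ in lo *.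
  have P_ge0 : 0 <= P by rewrite mulr_ge0 ?ler0n.
  have hi : a m * P <= (a n + c / 2) * P.
    by rewrite ler_wpM2r // ltW // am // geq_max hn fn.
  have countP : a m * ('C(m, h))%:R * ('C(n, m))%:R = a m * P.
    by rewrite /P; ring.
  rewrite countP in count.
  have split_c : (a n + c) * P = (a n + c / 2) * P + c / 2 * P by field.
  lra.
have NF_bin : c / 2 * ('C(n, f))%:R
    <= (copy_bound m)%:R * (ncopies F G)%:R * ('C(m, f))%:R.
  rewrite -(ler_pM2r (bin_pos _ _ mn)).
  have one_le : 1 <= ('C(m, h))%:R :> R by rewrite ler1n bin_gt0.
  (* The factor C(m, h) of the lower bound in [excess] is bounded below by 1. *)
  have weaken : c / 2 * ('C(n, m))%:R
      <= c / 2 * (('C(n, m))%:R * ('C(m, h))%:R).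
    by rewrite ler_pM2l // ler_peMr ?ler0n.
  rewrite mulrAC; apply: le_trans (ler_wpM2r (ler0n R _) weaken) _.
  apply: le_trans (ler_wpM2r (ler0n R _) excess) _.
  rewrite -[X in _ <= X]mulrA [_%:R * 'C(n, m)%:R]mulrC -idF.
  lra.
apply: (@le_trans _ _ ((f ^ f)%:R * (c / 2 * ('C(n, f))%:R))).
  rewrite mulrCA ler_pM2l // -natrX -natrM ler_nat; exact: expn_leq_bin.
rewrite /K !natrM; apply: le_trans (ler_wpM2l (ler0n R (f ^ f)) NF_bin) _.
lra.
Qed.
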